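(* Let $(\mathcal X_+,\mathcal X_0,\mathcal X_-)$ be a quasi Gelfand triple of Hilbert spaces and $G_+$ its Gram operator. Then $\operatorname{ran}\iota_+=\operatorname{dom}G_+^{1/2}$ and $$\langle f,g\rangle_{\mathcal X_+}=\langle G_+^{1/2}f,G_+^{1/2}g\rangle_{\mathcal X_0}\qquad\text{for all } f,g\in\operatorname{dom}G_+^{1/2}.$$ In particular, $\|f\|_{\mathcal X_+}=\|G_+^{1/2}f\|_{\mathcal X_0}$ for all $f\in\operatorname{dom}G_+^{1/2}$.
   Context: All spaces are complex; the anti-dual $X'$ of a Banach space $X$ is the space of continuous antilinear functionals on $X$. For Banach spaces $X,Y$ and a continuous sesquilinear form $\langle\cdot,\cdot\rangle_{Y,X}:Y\times X\to\mathbb C$ (linear in the first, antilinear in the second argument), put $\langle x,y\rangle_{X,Y}:=\overline{\langle y,x\rangle_{Y,X}}$. $(X,Y)$ is a complete dual pair if $Y\to X'$, $y\mapsto\langle y,\cdot\rangle_{Y,X}$ and $X\to Y'$, $x\mapsto\langle x,\cdot\rangle_{X,Y}$ are both isometric and bijective. A pre-quasi Gelfand triple $(\mathcal X_+,\mathcal X_0,\mathcal X_-)$ consists of a complete dual pair $(\mathcal X_+,\mathcal X_-)$, a Hilbert space $\mathcal X_0$ and linear maps $\iota_\pm:\operatorname{dom}\iota_\pm\subseteq\mathcal X_\pm\to\mathcal X_0$ that are densely defined, closed, injective and have dense range, with $\langle g,f\rangle_{\mathcal X_-,\mathcal X_+}=\langle\iota_-g,\iota_+f\rangle_{\mathcal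 X_0}$ for all $f\in\operatorname{dom}\iota_+$, $g\in\operatorname{dom}\iota_-$. It is a quasi Gelfand triple if in addition $\operatorname{dom}\iota_+^*=\operatorname{ran}\iota_-$, where $\operatorname{dom}\iota_+^*$ is the set of $h\in\mathcal X_0$ for which $\operatorname{dom}\iota_+\ni f\mapsto\langle h,\iota_+f\rangle_{\mathcal X_0}$ is continuous with respect to $\|\cdot\|_{\mathcal X_+}$. It is ``of Hilbert spaces'' if $\mathcal X_+$ and $\mathcal X_-$ are Hilbert spaces. For $f,g\in\operatorname{ran}\iota_+$ one writes $\langle f,g\rangle_{\mathcal X_+}:=\langle\iota_+^{-1}f,\iota_+^{-1}g\rangle_{\mathcal X_+}$ and $\|f\|_{\mathcal X_+}:=\|\iota_+^{-1}f\|_{\mathcal X_+}$. The Gram operator is $G_+:=(\iota_+^{-1})^{*_{\mathrm h}}\iota_+^{-1}=(\iota_+\iota_+^{*_{\mathrm h}})^{-1}:\operatorname{dom}G_+\subseteq\mathcal X_0\to\mathcal X_0$, where $*_{\mathrm h}$ denotes the usual Hilbert space adjoint with respect to the inner products of $\mathcal X_0$ and $\mathcal X_+$. It is self-adjoint and positive (not necessarily coercive), and $G_+^{1/2}$ is its positive self-adjoint square root. *)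

(* Defs.v *)
From HB Require Import structures.
From mathcomp Require Import all_boot all_order all_algebra sesquilinear.
From mathcomp Require Import complex.
From mathcomp Require Import boolp classical_sets functions reals topology.
From mathcomp Require Import normedtype.

Set Implicit Arguments.
Unset Strict Implicit.
Unset Printing Implicit Defensive.

Import Order.TTheory GRing.Theory Num.Theory.
Import numFieldNormedType.Exports.

Local Open Scope classical_set_scope.
Local Open Scope ring_scope.
Local Open Scope complex_scope.

HB.mixin Record CompleteNormedModule_isHilbert (R : realType) X
    of CompleteNormedModule R[i] X := {
  inner : {dot X for @Num.conj R[i]} ;
  inner_norm : forall x : X, inner x x = `|x| ^+ 2
}.

#[short(type="hilbertType")]
HB.structure Definition Hilbert (R : realType) :=
  {X of CompleteNormedModule R[i] X & CompleteNormedModule_isHilbert R X}.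

(* A possibly unbounded operator T : dom T `<=` X -> Y is represented by its
   graph, a subset of X * Y. *)
Section Operators.
Variables (K : numFieldType) (X Y Z : normedModType K).
Implicit Type T : set (X * Y).

Definition is_linear_op T :=
  [/\ T (0, 0),
      forall (a : K) u v, T u -> T v -> T (a *: u + v)
    & forall x y y', T (x, y) -> T (x, y') -> y = y'].

Definition op_dom T : set X := [set x | exists y, T (x, y)].
Definition op_ran T : set Y := [set y | exists x, T (x, y)].

(* The value is 0, by convention, when x is not in op_dom T. *)
Definition op_val T (x : X) : Y := xget 0 [set y | T (x, y)].

Definition op_inv T : set (Y * X) := [set p | T (p.2, p.1)].

(* op_comp S T is the product S T, in which T is applied first. *)
Definition op_comp (S : set (Y * Z)) T : set (X * Z) :=
  [set p | exists y, T (p.1, y) /\ S (y, p.2)].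

End Operators.

Section DualPair.
Variable R : realType.
(* The regular module R[i]^o carries the norm topology of the complex field. *)
Local Notation C := (R[i]^o).
Local Notation sesquilinear Y X :=
  {bilinear Y -> X -> R[i] | *%R & (@Num.conj R[i]) \; *%R}.

Definition antidual (X : completeNormedModType R[i]) : set (X -> C) :=
  [set phi | (forall (a : R[i]) x x',
               phi (a *: x + x') = (Num.conj a) * phi x + phi x') /\
             continuous phi].

(* The operator norm; `|phi x| is a real number embedded in R[i], and the set is
   bounded as soon as phi is in antidual X. *)
Definition antidual_norm (X : completeNormedModType R[i]) (phi : X -> C) : R :=
  sup [set complex.Re `|phi x| | x in [set x : X | `|x| <= 1]].

(* y |-> form y is an isometric bijection of Y onto the anti-dual of X. *)
Definition isometric_bijective (X Y : completeNormedModType R[i])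
    (form : Y -> X -> C) :=
  (forall y, `|y| = (antidual_norm (form y))%:C) /\
  set_bij [set: Y] (@antidual X) form.

(* form y x is <y, x>_{Y, X}, linear in y and antilinear in x. *)
Definition complete_dual_pair (X Y : completeNormedModType R[i])
    (form : sesquilinear Y X) :=
  [/\ continuous (fun p : Y * X => form p.1 p.2 : C),
      isometric_bijective (fun (y : Y) (x : X) => form y x)
    & isometric_bijective (fun (x : X) (y : Y) => Num.conj (form y x))].

Section Triple.
Variables (Xp Xm : completeNormedModType R[i]) (X0 : hilbertType R).
Variables (form : sesquilinear Xm Xp).
Variables (ip : set (Xp * X0)) (im : set (Xm * X0)).

Definition is_embedding (X : completeNormedModType R[i]) (i : set (X * X0)) :=
  [/\ is_linear_op i, dense (op_dom i), closed i,
      set_inj (op_dom i) (op_val i) & dense (op_ran i)].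

Definition pre_quasi_gelfand_triple :=
  [/\ complete_dual_pair form, is_embedding ip, is_embedding im &
      forall f g, op_dom ip f -> op_dom im g ->
        form g f = inner (op_val im g) (op_val ip f)].

(* The domain of the adjoint of ip with respect to the dual pair; op_dom ip is
   given the topology induced by the norm of Xp. *)
Definition dom_adjoint : set X0 :=
  [set h | {within op_dom ip, continuous (fun f => inner h (op_val ip f) : C)}].

Definition quasi_gelfand_triple :=
  pre_quasi_gelfand_triple /\ dom_adjoint = op_ran im.

End Triple.
End DualPair.

Section HilbertOperators.
Variable R : realType.

(* The graph of the usual adjoint when T is densely defined; in general only a
   linear relation. *)
Definition hilbert_adjoint (X Y : hilbertType R) (T : set (X * Y)) :
    set (Y * X) :=
  [set p | forall x y, T (x, y) -> inner y p.1 = inner x p.2].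

Definition self_adjoint (X : hilbertType R) (S : set (X * X)) :=
  [/\ is_linear_op S, dense (op_dom S) & hilbert_adjoint S = S].

Definition positive_op (X : hilbertType R) (S : set (X * X)) :=
  forall f, op_dom S f -> 0 <= inner (op_val S f) f.

Definition is_positive_sqrt (X : hilbertType R) (G S : set (X * X)) :=
  [/\ self_adjoint S, positive_op S & op_comp S S = G].

Variables (Xp X0 : hilbertType R) (ip : set (Xp * X0)).

Definition gram_operator : set (X0 * X0) :=
  op_comp (hilbert_adjoint (op_inv ip)) (op_inv ip).

(* The inner product and the norm of Xp, transported to op_ran ip. *)
Definition inner_plus (f g : X0) : R[i] :=
  inner (op_val (op_inv ip) f) (op_val (op_inv ip) g).

Definition norm_plus (f : X0) : R[i] := `|op_val (op_inv ip) f|.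

End HilbertOperators.

(* Main.v *)
(* Put T := ip^-1, a closed operator with T^* T = G_+ = S^* S. By von Neumann,
   the common domain D of T^* T and S^* S is a core for both T and S, and on D
   <T u, T v> = <T^* T u, v> = <S^* S u, v> = <S u, S v>. So the two graph norms
   agree on D, and completing D in them gives dom T = dom S and the identity on
   all of it. Everything rests on orthogonal projections in products X * Y, whose
   library norm is the maximum norm: hence the separate bilinear form [pdot]. *)
Require Import Defs.
From mathcomp Require Import all_boot all_order all_algebra sesquilinear.
From mathcomp Require Import complex.
From mathcomp Require Import boolp classical_sets functions reals topology.
From mathcomp Require Import normedtype.
From mathcomp Require Import interval_inference ring lra.

Set Implicit Arguments.
Unset Strict Implicit.

Import Order.TTheory GRing.Theory Num.Theory.
Import numFieldNormedType.Exports.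

Local Open Scope classical_set_scope.
Local Open Scope ring_scope.

(** * The real scalar product underlying a complex Hilbert space *)

Section RealInner.
Variables (R : realType) (X : hilbertType R).
Implicit Types (x y z : X).

(** The real part keeps all estimates in the ordered field [R]; [inner_rdot] recovers the complex
    identities. *)
Definition rdot x y : R := complex.Re (inner x y).

Lemma rdotC x y : rdot x y = rdot y x.
Proof.
rewrite /rdot (hermC (inner : {dot X for _}) x y) /=.
rewrite expr0 mul1r; by case: (inner y x).
Qed.

Lemma rdotDl x y z : rdot (x + y) z = rdot x z + rdot y z.
Proof. by rewrite /rdot linearDl raddfD. Qed.

Lemma rdotZl (a : R) x y : rdot (a%:C%C *: x) y = a * rdot x y.
Proof.
rewrite /rdot linearZl_LR /=; case: (inner x y) => u v /=.
by rewrite mul0r subr0.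
Qed.

Lemma rdot_iZl x y : rdot ('i%C *: x) y = - complex.Im (inner x y).
Proof.
rewrite /rdot linearZl_LR /=; case: (inner x y) => u v /=.
by rewrite mul0r mul1r sub0r.
Qed.

Lemma rdotxx x : `|x| ^+ 2 = (rdot x x)%:C%C.
Proof.
rewrite /rdot inner_norm.
have: `|x| ^+ 2 \is Num.real by rewrite rpredX// normr_real.
by move=> /complex_realP[k ->].
Qed.

Lemma rdot_ge0 x : 0 <= rdot x x.
Proof. by rewrite -lecR -rdotxx exprn_ge0. Qed.

Lemma rdot_eq0 x : rdot x x = 0 -> x = 0.
Proof.
by move=> h; apply/eqP; rewrite -normr_eq0 -sqrf_eq0 rdotxx h.
Qed.

Lemma rdot_ltr_norm x (e : R) : 0 < e -> rdot x x < e ^+ 2 -> `|x| < e%:C%C.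
Proof.
move=> e0 h; rewrite -(@ltr_pXn2r _ 2) ?nnegrE ?normr_ge0 ?lecR ?ltW//.
by rewrite rdotxx -rmorphXn/= ltcR.
Qed.

Lemma rdot_norm_lt x (e : R) : 0 < e -> `|x| < e%:C%C -> rdot x x < e ^+ 2.
Proof.
move=> e0 h; rewrite -ltcR -rdotxx rmorphXn/=.
by rewrite ltr_pXn2r ?nnegrE ?normr_ge0 ?lecR ?ltW.
Qed.

Lemma rdotNl x y : rdot (- x) y = - rdot x y.
Proof. by rewrite -scaleN1r -(rmorphN1 (real_complex R)) rdotZl mulN1r. Qed.

Lemma rdotBl x y z : rdot (x - y) z = rdot x z - rdot y z.
Proof. by rewrite rdotDl rdotNl. Qed.

Lemma rdot0l x : rdot 0 x = 0.
Proof. by rewrite /rdot linear0l. Qed.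

Lemma rdot_complete (x : nat -> X) :
  (forall e : R, 0 < e -> exists N, forall n k, (N <= n)%N -> (N <= k)%N ->
    rdot (x n - x k) (x n - x k) < e) ->
  exists w, forall e : R, 0 < e -> exists N, forall n, (N <= n)%N ->
    rdot (w - x n) (w - x n) < e.
Proof.
move=> hx.
have /cauchy_cvgP/cvg_ex[w xw] : cauchy (x @ \oo).
  apply/cauchy_ballP => e e0; have /complex_realP[r rE] := gtr0_real e0.
  move: e0; rewrite {}rE ltcR => r0; have [N hN] := hx _ (exprn_gt0 2 r0).
  exists (x @` [set n | (N <= n)%N], x @` [set n | (N <= n)%N]).
    by split; exists N => // n Nn; exists n.
  move=> [_ _] /= [[n Nn <-] [k Nk <-]]; rewrite -ball_normE /=.
  by apply: rdot_ltr_norm => //; exact: hN.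
exists w => e e0; have r0 : 0 < Num.sqrt e by rewrite sqrtr_gt0.
have := xw; move=> /cvgrPdist_lt /(_ (Num.sqrt e)%:C%C).
rewrite ltcR => /(_ r0)[N _ hN]; exists N => n Nn.
by rewrite -(sqr_sqrtr (ltW e0)); apply: rdot_norm_lt => //; exact: hN.
Qed.

End RealInner.

(** Up to sign, the imaginary part of [inner] is its real part after scaling the first argument by
    ['i]. *)
Lemma inner_rdot (R : realType) (X Y : hilbertType R) (x x' : X) (y y' : Y) :
  rdot x x' = rdot y y' -> rdot ('i%C *: x) x' = rdot ('i%C *: y) y' ->
  inner x x' = inner y y'.
Proof.
rewrite !rdot_iZl /rdot; case: (inner x x') => a b; case: (inner y y') => c d /=.
by move=> -> /oppr_inj ->.
Qed.

(** Serves in place of passing to a limit: Cauchy-Schwarz yields such bounds with [K] fixed and [e]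
    arbitrarily small. *)
Lemma sqr_small_eq0 (R : realType) (x K : R) :
  (forall e, 0 < e -> x ^+ 2 <= e * K) -> x = 0.
Proof.
move=> h; apply/eqP; rewrite -sqrf_eq0; apply/negPn/negP => x0.
have x2 : 0 < x ^+ 2 by rewrite lt_neqAle eq_sym x0 sqr_ge0.
have K0 : 0 < K by have := h _ ltr01; lra.
(* This [e] turns the bound into [x ^+ 2 <= x ^+ 2 / 2]. *)
have := h (x ^+ 2 / (2 * K)) (divr_gt0 x2 (mulr_gt0 (ltr0n R 2) K0)).
have -> : x ^+ 2 / (2 * K) * K = x ^+ 2 / 2 by field; rewrite gt_eqF.
by lra.
Qed.

Lemma natSinv_lt (R : realType) (e : R) : 0 < e ->
  exists N, forall n, (N <= n)%N -> n.+1%:R^-1 < e.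
Proof.
move=> e0; have [N _ hN] := near_infty_natSinv_lt (PosNum e0).
by exists N => n; exact: hN.
Qed.

(** * Hilbert geometry of the product [X * Y] and orthogonal projection *)

Section PairInner.
Variables (R : realType) (X Y : hilbertType R).
Implicit Types (p r u v w m : X * Y) (M : set (X * Y)).

Definition pdot p r : R := rdot p.1 r.1 + rdot p.2 r.2.

Lemma pdotC p r : pdot p r = pdot r p.
Proof. by rewrite /pdot [rdot p.1 _]rdotC [rdot p.2 _]rdotC. Qed.

Lemma pdotDl p r u : pdot (p + r) u = pdot p u + pdot r u.
Proof. by rewrite /pdot !rdotDl; ring. Qed.

Lemma pdotZl (a : R) p r : pdot (a%:C%C *: p) r = a * pdot p r.
Proof. by rewrite /pdot !rdotZl mulrDr. Qed.

Lemma pdotNl p r : pdot (- p) r = - pdot p r.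
Proof. by rewrite /pdot !rdotNl opprD. Qed.

Lemma pdotBl p r u : pdot (p - r) u = pdot p u - pdot r u.
Proof. by rewrite pdotDl pdotNl. Qed.

Lemma pdotDr p r u : pdot p (r + u) = pdot p r + pdot p u.
Proof. by rewrite !(pdotC p) pdotDl. Qed.

Lemma pdotZr (a : R) p r : pdot p (a%:C%C *: r) = a * pdot p r.
Proof. by rewrite !(pdotC p) pdotZl. Qed.

Lemma pdotNr p r : pdot p (- r) = - pdot p r.
Proof. by rewrite !(pdotC p) pdotNl. Qed.

Lemma pdotBr p r u : pdot p (r - u) = pdot p r - pdot p u.
Proof. by rewrite pdotDr pdotNr. Qed.

Definition pdotE := (pdotBl, pdotBr, pdotDl, pdotDr, pdotNl, pdotNr, pdotZl,
  pdotZr).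

Lemma pdot_ge0 p : 0 <= pdot p p.
Proof. by rewrite addr_ge0 ?rdot_ge0. Qed.

(** The parallelogram law with the square of [p + r] dropped; it acts as a triangle inequality for
    squared norms. *)
Lemma pdot_distr_le p r :
  pdot (p - r) (p - r) <= 2 * pdot p p + 2 * pdot r r.
Proof. by have := pdot_ge0 (p + r); rewrite !pdotE (pdotC r p); lra. Qed.

(* With [e = pdot v v] the hypothesis is trivial and this is Cauchy-Schwarz. *)
Lemma pdot_sqr_le (e : R) v m :
  (forall s : R, pdot v v - e <= pdot (v - s%:C%C *: m) (v - s%:C%C *: m)) ->
  pdot v m ^+ 2 <= e * pdot m m.
Proof.
move=> h; have {}h s : 2 * s * pdot v m - s ^+ 2 * pdot m m <= e.
  by have := h s; rewrite !pdotE (pdotC m v); lra.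
have := pdot_ge0 m; set q := pdot m m in h *; set b := pdot v m in h *.
rewrite le_eqVlt => /orP[/eqP q0|q0].
  rewrite -q0 mulr0; have [->|b0] := eqVneq b 0; first by rewrite expr0n.
  (* For [q = 0] the bound is linear in [s], and this [s] would give [e + 1 <= e]. *)
  have := h ((e + 1) / (2 * b)); rewrite -q0 mulr0 subr0.
  suff -> : 2 * ((e + 1) / (2 * b)) * b = e + 1 by lra.
  by field.
(* [s = b / q] maximises [2 * s * b - s ^+ 2 * q]. *)
have := h (b / q).
have -> : 2 * (b / q) * b - (b / q) ^+ 2 * q = b ^+ 2 / q.
  by field; rewrite gt_eqF.
by rewrite ler_pdivrMr.
Qed.

Lemma pdot_cauchy_schwarz v m : pdot v m ^+ 2 <= pdot v v * pdot m m.
Proof. by apply: pdot_sqr_le => s; rewrite subrr pdot_ge0. Qed.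

Definition pdot_closure M : set (X * Y) :=
  [set w | forall e : R, 0 < e -> exists2 m, M m & pdot (w - m) (w - m) < e].

Definition pdot_lim (m : nat -> X * Y) w :=
  forall e : R, 0 < e -> exists N, forall n, (N <= n)%N ->
    pdot (w - m n) (w - m n) < e.

(** Each component norm is at most the [pdot] norm, so every product neighbourhood contains a [pdot]
    ball. *)
Lemma closed_pdot_closure M : closed M -> pdot_closure M `<=` M.
Proof.
move=> cM w hw; apply: cM => B /= [[B1 B2] [/= nB1 nB2] sB].
have /nbhs_ballP[e1 /= e10 sB1] := nB1.
have /nbhs_ballP[e2 /= e20 sB2] := nB2.
have /complex_realP[r1 r1E] := gtr0_real e10.
have /complex_realP[r2 r2E] := gtr0_real e20.
move: e10 e20 sB1 sB2; rewrite {}r1E {}r2E !ltcR => r10 r20 sB1 sB2.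
have [m Mm mlt] : exists2 m, M m &
    pdot (w - m) (w - m) < Order.min (r1 ^+ 2) (r2 ^+ 2).
  by apply: hw; rewrite lt_min !exprn_gt0.
move: mlt; rewrite lt_min => /andP[lt1 lt2].
exists m; split=> //; apply: sB; split; [apply: sB1|apply: sB2];
  rewrite -ball_normE /=; apply: rdot_ltr_norm => //.
- by apply: le_lt_trans lt1; rewrite lerDl rdot_ge0.
- by apply: le_lt_trans lt2; rewrite lerDr rdot_ge0.
Qed.

Lemma pdot_complete (m : nat -> X * Y) :
  (forall n k, pdot (m n - m k) (m n - m k) <= 2 * (n.+1%:R^-1 + k.+1%:R^-1)) ->
  exists w, pdot_lim m w.
Proof.
move=> hm.
have small (e : R) : 0 < e -> exists N, forall n k, (N <= n)%N -> (N <= k)%N ->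
    pdot (m n - m k) (m n - m k) < e.
  move=> e0; have [N hN] := natSinv_lt (divr_gt0 e0 (ltr0n R 4)).
  exists N => n k Nn Nk; have := hN _ Nn; have := hN _ Nk.
  by have := hm n k; set a := n.+1%:R^-1; set b := k.+1%:R^-1; lra.
have [w1 hw1] : exists w : X, forall e : R, 0 < e -> exists N, forall n, (N <= n)%N ->
    rdot (w - (m n).1) (w - (m n).1) < e.
  apply: rdot_complete => e /small[N hN]; exists N => n k Nn Nk.
  by apply: le_lt_trans (hN _ _ Nn Nk); rewrite lerDl rdot_ge0.
have [w2 hw2] : exists w : Y, forall e : R, 0 < e -> exists N, forall n, (N <= n)%N ->
    rdot (w - (m n).2) (w - (m n).2) < e.
  apply: rdot_complete => e /small[N hN]; exists N => n k Nn Nk.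
  by apply: le_lt_trans (hN _ _ Nn Nk); rewrite lerDr rdot_ge0.
exists (w1, w2) => e e0.
have [N1 h1] := hw1 _ (divr_gt0 e0 (ltr0n R 2)).
have [N2 h2] := hw2 _ (divr_gt0 e0 (ltr0n R 2)).
exists (maxn N1 N2) => n; rewrite geq_max => /andP[/h1 + /h2].
by rewrite /pdot /=; lra.
Qed.

(* By the parallelogram law a minimising sequence in [M] is Cauchy, and
   near-minimality makes its residuals almost orthogonal to [M]. *)
Lemma pdot_projection M p :
  M 0 -> (forall (a : R) u v, M u -> M v -> M (a%:C%C *: u + v)) ->
  exists2 w, pdot_closure M w & forall m, M m -> pdot (p - w) m = 0.
Proof.
move=> M0 Mlin.
pose D := [set pdot (p - m) (p - m) | m in M].
have Dlb : has_lbound D by exists 0 => _ [m _ <-]; exact: pdot_ge0.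
have D0 : D !=set0 by exists (pdot (p - 0) (p - 0)), 0.
have infD m : M m -> inf D <= pdot (p - m) (p - m).
  by move=> Mm; apply: ge_inf => //; exists m.
have /choice[m hm] : forall n : nat, exists m : X * Y,
    M m /\ pdot (p - m) (p - m) < inf D + n.+1%:R^-1.
  move=> n; have [||_ [m Mm <-] lt] := @inf_adherent _ D n.+1%:R^-1.
  - by rewrite invr_gt0.
  - by split.
  - by exists m.
have [w hw] : exists w, pdot_lim m w.
  apply: pdot_complete => n k.
  have [Mn ltn] := hm n; have [Mk ltk] := hm k.
  (* The midpoint of two near-minimisers lies in [M], so its squared distance to [p] is at least
     [inf D]. *)
  have Mh : M (2^-1%:C%C *: m n + (2^-1%:C%C *: m k + 0)) by apply: (Mlin _ _ _ Mn); apply: Mlin.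
  have := infD _ Mh; rewrite addr0; move: ltn ltk.
  rewrite !pdotE (pdotC (m n) p) (pdotC (m k) p) (pdotC (m k) (m n)).
  by set a := n.+1%:R^-1; set b := k.+1%:R^-1; lra.
exists w => [e /hw[N hN]|u Mu]; first by exists (m N); [case: (hm N)|exact: hN].
have sqr_le (n : nat) :
    pdot (p - m n) u ^+ 2 <= n.+1%:R^-1 * pdot u u.
  have [Mn ltn] := hm n.
  apply: pdot_sqr_le => s.
  have := infD _ (Mlin s _ _ Mu Mn); rewrite [_ + m n]addrC opprD addrA.
  by move: ltn; set a := n.+1%:R^-1; lra.
(* The factor 4 comes from [(a - b) ^+ 2 <= 2 * a ^+ 2 + 2 * b ^+ 2], both squares being at most
   [e * pdot u u]. *)
apply: (@sqr_small_eq0 _ _ (4 * pdot u u)) => e e0.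
have [N1 h1] := natSinv_lt e0.
have [N2 h2] := hw _ e0.
pose n := maxn N1 N2.
have l1 := h1 n (leq_maxl _ _); have l2 := h2 n (leq_maxr _ _).
have s1 := sqr_le n; have s2 := pdot_cauchy_schwarz (w - m n) u.
have -> : pdot (p - w) u = pdot (p - m n) u - pdot (w - m n) u.
  by rewrite !pdotE; ring.
have q0 := pdot_ge0 u.
have {}s1 : pdot (p - m n) u ^+ 2 <= e * pdot u u.
  by apply: le_trans s1 _; rewrite ler_wpM2r// ltW.
have {}s2 : pdot (w - m n) u ^+ 2 <= e * pdot u u.
  by apply: le_trans s2 _; rewrite ler_wpM2r// ltW.
have := sqr_ge0 (pdot (p - m n) u + pdot (w - m n) u).
by move: s1 s2; set a := pdot _ u; set b := pdot _ u; nra.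
Qed.

End PairInner.

(** * Adjoints as orthogonal complements, and the core of a closed operator *)

Section Core.
Variables (R : realType) (X Y : hilbertType R) (T : set (X * Y)).
Hypothesis linT : is_linear_op T.

(* A real orthogonality relation against a complex subspace is a complex one:
   test it against [v] and ['i *: v]. *)
Lemma hilbert_adjointP y x : hilbert_adjoint T (y, x) <->
  (forall v, T v -> rdot v.2 y = rdot v.1 x).
Proof.
have [T0 Tlin _] := linT; split=> [h [a b] /h|h a b Tab] /=.
  by rewrite /rdot => ->.
apply: inner_rdot; first exact: h Tab.
by have := h _ (Tlin 'i%C _ _ Tab T0); rewrite addr0.
Qed.

(** The adjoint is the orthogonal complement of the rotated graph of all [(v.2, - v.1)] with [T v],
    hence closed. *)
Lemma hilbert_adjoint_closure :
  pdot_closure (hilbert_adjoint T) `<=` hilbert_adjoint T.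
Proof.
move=> [y x] h; apply/hilbert_adjointP => v Tv; apply/subr0_eq.
apply: (@sqr_small_eq0 _ _ (pdot (v.2, - v.1) (v.2, - v.1))).
move=> e /h[[y' x'] /hilbert_adjointP/(_ v Tv) adj' lt].
have -> : rdot v.2 y - rdot v.1 x = pdot (y - y', x - x') (v.2, - v.1).
  rewrite /pdot /= !rdotBl [rdot x _]rdotC [rdot x' _]rdotC !rdotNl.
  by rewrite [rdot y _]rdotC [rdot y' _]rdotC adj'; ring.
apply: le_trans (pdot_cauchy_schwarz _ _) _.
by rewrite ler_wpM2r ?pdot_ge0// ltW.
Qed.

Hypothesis closedT : pdot_closure T `<=` T.

(* von Neumann: the domain of [T^* T] is a core for the closed operator [T]. *)
Lemma adjoint_core : T `<=` pdot_closure [set u | T u /\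
  exists h, hilbert_adjoint T (u.2, h)].
Proof.
have [T0 Tlin Tfun] := linT; set M := [set u | _].
have MT : M `<=` T by move=> u [].
move=> p Tp.
(* The residual [p - w] lies in [T] and is orthogonal to [M]; the goal is that it vanishes. *)
have [||w Mw pw] := @pdot_projection R X Y M p.
- split=> //; exists 0; apply/hilbert_adjointP => v _ /=.
  by rewrite ![rdot _ 0]rdotC !rdot0l.
- move=> a u v [Tu [h /hilbert_adjointP hh]] [Tv [k /hilbert_adjointP hk]].
  split; first exact: Tlin.
  exists (a%:C%C *: h + k); apply/hilbert_adjointP => z Tz /=.
  rewrite ![rdot _ (_ *: _ + _)]rdotC !rdotDl !rdotZl.
  by rewrite ![rdot _ z.1]rdotC ![rdot _ z.2]rdotC hh ?hk.
have Tw : T w by apply: closedT => e /Mw[m /MT Tm]; exists m.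
have Tr : T (p - w) by rewrite addrC -scaleN1r; apply: Tlin.
(* Projecting [((p - w).1, 0)] on [T] solves [u.1 + T^* T u.1 = (p - w).1]. *)
have [|u Tu ru] := @pdot_projection R X Y T ((p - w).1, 0) T0.
  by move=> a; exact: Tlin.
have {}Tu : T u by exact: closedT.
have Mu : M u.
  split=> //; exists ((p - w).1 - u.1); apply/hilbert_adjointP => v /ru.
  rewrite /pdot /= sub0r rdotNl.
  by rewrite [rdot (_ - _) _]rdotC [rdot u.2 _]rdotC; lra.
(* The second relation equates the square of [(p - w).1] with [pdot u (p - w)], which is 0 by the
   first; single-valuedness of [T] then kills [(p - w).2]. *)
have := pw _ Mu; have := ru _ Tr.
rewrite /pdot /= sub0r rdotNl rdotBl.
rewrite [rdot u.1 _]rdotC [rdot u.2 _]rdotC => h1 h2.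
have r1 : p.1 - w.1 = 0 by apply: rdot_eq0; lra.
have r2 : p.2 - w.2 = 0 by apply: (Tfun 0) => //; rewrite -{1}r1.
by rewrite [p]surjective_pairing (subr0_eq r1) (subr0_eq r2) -surjective_pairing.
Qed.

End Core.

(** * Comparison of two closed operators with the same Gram operator *)

Section Transfer.
Variables (R : realType) (X Y Z : hilbertType R).
Variables (T : set (X * Y)) (S : set (X * Z)).
Hypotheses (linT : is_linear_op T) (closedT : pdot_closure T `<=` T).
Hypotheses (linS : is_linear_op S) (closedS : pdot_closure S `<=` S).
Hypothesis TS : op_comp (hilbert_adjoint T) T = op_comp (hilbert_adjoint S) S.

(* [S] maps a sequence of the core converging to [f] in the graph norm of [T]
   to a Cauchy sequence, as both graph norms agree on the core. *)
Lemma gram_transfer f a : T (f, a) -> exists2 b, S (f, b) &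
  forall g c d, T (g, c) -> S (g, d) -> inner c a = inner d b.
Proof.
move=> Tfa; have core := adjoint_core linT closedT Tfa.
have /choice[m hm] : forall n : nat, exists u : X * (Y * Z),
    [/\ T (u.1, u.2.1), S (u.1, u.2.2),
      pdot ((f, a) - (u.1, u.2.1)) ((f, a) - (u.1, u.2.1)) < n.+1%:R^-1 &
      forall g c d, T (g, c) -> S (g, d) -> inner c u.2.1 = inner d u.2.2].
  move=> n; have [|[u v] [Tuv [h /= Th]] lt] := core n.+1%:R^-1.
    by rewrite invr_gt0.
  (* The common value [h] at [u] makes both [inner c v] and [inner d w] equal to [inner g h]. *)
  have : op_comp (hilbert_adjoint T) T (u, h) by exists v.
  rewrite TS => -[w [/= Suw Sh]]; exists (u, (v, w)); split=> //= g c d.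
  by move=> /Th /= -> /Sh /= ->.
pose p n := ((m n).1, (m n).2.1); pose q n := ((m n).1, (m n).2.2).
have Tp n : T (p n) by case: (hm n).
have Sq n : S (q n) by case: (hm n).
have ltp n : pdot ((f, a) - p n) ((f, a) - p n) < n.+1%:R^-1 by case: (hm n).
have ipq n g c d : T (g, c) -> S (g, d) -> rdot c (p n).2 = rdot d (q n).2.
  by case: (hm n) => _ _ _ h Tgc Sgd; rewrite /rdot (h _ _ _ Tgc Sgd).
have [w qw] : exists w, pdot_lim q w.
  apply: pdot_complete => n k.
  have -> : pdot (q n - q k) (q n - q k) = pdot (p n - p k) (p n - p k).
    by rewrite !pdotE /pdot /= !(ipq _ _ _ _ (Tp _) (Sq _)).
  have -> : p n - p k = ((f, a) - p k) - ((f, a) - p n).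
    by rewrite opprB [RHS]addrC addrA subrK.
  apply: le_trans (pdot_distr_le _ _) _; have := ltp n; have := ltp k.
  by set x := n.+1%:R^-1; set y := k.+1%:R^-1; lra.
have w1 : w.1 = f.
  apply/subr0_eq/rdot_eq0/eqP; rewrite eq_le rdot_ge0 andbT.
  apply/ler_addgt0Pr => e e0; rewrite add0r.
  have e4 : 0 < e / 4 by rewrite divr_gt0.
  have [N1 h1] := natSinv_lt e4; have [N2 h2] := qw _ e4.
  pose n := maxn N1 N2.
  have l1 := lt_trans (ltp n) (h1 n (leq_maxl _ _)).
  have l2 := h2 n (leq_maxr _ _).
  (* Padding by 0 lets the inequality for pairs act on first components alone. *)
  pose x : X * Y := (w.1 - (q n).1, 0); pose y : X * Y := (f - (p n).1, 0).
  have := pdot_distr_le x y.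
  have -> : x - y = (w.1 - f, 0).
    by rewrite /x /y; congr pair; rewrite /= ?subrr// opprB addrA subrK.
  have := rdot_ge0 ((f, a) - p n).2; have := rdot_ge0 (w - q n).2.
  by move: l1 l2; rewrite /pdot /= !rdot0l; lra.
have Sfw : S (f, w.2).
  rewrite -w1 -surjective_pairing; apply: closedS => e /qw[N hN].
  by exists (q N) => //; exact: hN.
exists w.2 => //.
have re g c d : T (g, c) -> S (g, d) -> rdot c a = rdot d w.2.
  move=> Tgc Sgd; apply/subr0_eq.
  apply: (@sqr_small_eq0 _ _ (2 * (rdot c c + rdot d d))) => e e0.
  have [N1 h1] := natSinv_lt e0; have [N2 h2] := qw _ e0.
  pose n := maxn N1 N2.
  have l1 := lt_trans (ltp n) (h1 n (leq_maxl _ _)).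
  have l2 := h2 n (leq_maxr _ _).
  (* The contributions of [p n] and [q n] cancel by [ipq], leaving two errors that tend to 0. *)
  have -> : rdot c a - rdot d w.2 =
      pdot ((f, a) - p n) (0, c) - pdot (w - q n) (0, d).
    rewrite !pdotE /pdot /= ![rdot _ 0]rdotC !rdot0l ![rdot _ c]rdotC.
    by rewrite ![rdot _ d]rdotC (ipq n _ _ _ Tgc Sgd); ring.
  have c1 := pdot_cauchy_schwarz ((f, a) - p n) (0, c).
  have c2 := pdot_cauchy_schwarz (w - q n) (0, d).
  have {}c1 : pdot ((f, a) - p n) (0, c) ^+ 2 <= e * rdot c c.
    apply: le_trans c1 _; rewrite [pdot (0, c) _]/pdot /= rdot0l add0r.
    by rewrite ler_wpM2r ?rdot_ge0// ltW.
  have {}c2 : pdot (w - q n) (0, d) ^+ 2 <= e * rdot d d.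
    apply: le_trans c2 _; rewrite [pdot (0, d) _]/pdot /= rdot0l add0r.
    by rewrite ler_wpM2r ?rdot_ge0// ltW.
  move: c1 c2; set x := pdot _ _; set y := pdot _ _ => c1 c2.
  by have := sqr_ge0 (x + y); nra.
move=> g c d Tgc Sgd; apply: inner_rdot; first exact: re Tgc Sgd.
have [T0 Tlin _] := linT; have [S0 Slin _] := linS.
have := Tlin 'i%C _ _ Tgc T0; have := Slin 'i%C _ _ Sgd S0.
by rewrite !addr0 => Sgd' Tgc'; exact: re Tgc' Sgd'.
Qed.

End Transfer.

(** * Inverses of injective closed operators *)

Section Inverse.
Variables (R : realType) (X Y : hilbertType R) (T : set (X * Y)).

Lemma op_valP f : op_dom T f -> T (f, op_val T f).
Proof. by move=> [y Tfy]; rewrite /op_val; case: xgetP => [z _ //|/(_ y)]. Qed.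

Lemma is_linear_op_inv : is_linear_op T -> set_inj (op_dom T) (op_val T) ->
  is_linear_op (op_inv T).
Proof.
move=> [T0 Tlin Tfun] Tinj; split=> //.
  by move=> a u v Tu Tv; exact: Tlin Tu Tv.
have valE z y : T (z, y) -> op_val T z = y.
  by move=> Tzy; apply: (Tfun z) => //; apply: op_valP; exists y.
move=> y x x' /= Tx Tx'; apply: Tinj; rewrite ?inE.
- by exists y.
- by exists y.
- by rewrite (valE _ _ Tx) (valE _ _ Tx').
Qed.

(** Swapping the components preserves [pdot]. *)
Lemma pdot_closure_inv : closed T -> pdot_closure (op_inv T) `<=` op_inv T.
Proof.
move=> /closed_pdot_closure cT [y x] h; apply: cT => e /h[[y' x'] /= Tm lt].
by exists (x', y') => //; move: lt; rewrite /pdot /= addrC.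
Qed.

End Inverse.

(** * The inverse embedding compared with the square root of the Gram operator *)

Unset Implicit Arguments.
Set Strict Implicit.

Theorem theorem6p2 (R : realType) (Xp X0 Xm : hilbertType R)
    (form : {bilinear Xm -> Xp -> R[i] | *%R & (@Num.conj R[i]) \; *%R})
    (ip : set (Xp * X0)) (im : set (Xm * X0))
    (triple : quasi_gelfand_triple form ip im)
    (S : set (X0 * X0)) (sqrtS : is_positive_sqrt (gram_operator ip) S) :
  [/\ op_ran ip = op_dom S,
      forall f g : X0, op_dom S f -> op_dom S g ->
        inner_plus ip f g = inner (op_val S f) (op_val S g)
    & forall f : X0, op_dom S f -> norm_plus ip f = `|op_val S f|].
Proof.
have [[_ [linip _ clip injip _] _ _] _] := triple.
have [[linS _ adjS] _ SS] := sqrtS.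
have linA := is_linear_op_inv linip injip.
have clA := pdot_closure_inv clip.
(* [S] is closed because it is its own adjoint. *)
have clS : pdot_closure S `<=` S.
  by rewrite -adjS; exact: hilbert_adjoint_closure.
have AS : op_comp (hilbert_adjoint (op_inv ip)) (op_inv ip) =
    op_comp (hilbert_adjoint S) S by rewrite adjS SS.
have domE : op_ran ip = op_dom S.
  (* The hypotheses of the transfer are symmetric in the two operators, so it yields both
     inclusions. *)
  apply/seteqP; split=> f [a].
    by move=> /(gram_transfer linA clA linS clS AS)[b Sfb _]; exists b.
  by move=> /(gram_transfer linS clS linA clA (esym AS))[b Tfb _]; exists b.
have innerE f g : op_dom S f -> op_dom S g ->
    inner_plus ip f g = inner (op_val S f) (op_val S g).
  move=> Sf Sg; have [Af Ag] : op_dom (op_inv ip) f /\ op_dom (op_inv ip) g.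
    by move: Sf Sg; rewrite -domE.
  have [b Sgb h] := gram_transfer linA clA linS clS AS (op_valP Ag).
  have [_ _ Sfun] := linS.
  by rewrite (Sfun _ _ _ (op_valP Sg) Sgb); apply: h (op_valP Af) (op_valP Sf).
split=> // f Sf; apply/eqP.
rewrite -(@eqrXn2 _ 2) ?normr_ge0// /norm_plus -!inner_norm.
by apply/eqP; exact: innerE.
Qed.
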